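(* Let $G$ be a connected graph and $x\in V(G)$. Suppose that $G$ has a separable interval $t_G$-coloring $\alpha$ with respect to $x$ such that $1\in S(x,\alpha)$ and there exists a vertex $y\in N_{\epsilon(x)}(x)$ with $t_G\in S(y,\alpha)$. Then for any $r$-regular graph $H$ with an interval $t_H$-coloring, $$W(G\square H)\geq t_G+t_H+\epsilon(x)\,r.$$
   Context: All graphs are finite, undirected, without loops or multiple edges. An interval $t$-coloring of a graph $G$ ($t$ a positive integer) is a proper edge-coloring of $G$ with colors $1,\ldots,t$ such that all colors are used and, for each vertex $v$, the set of colors of the edges incident to $v$ is an interval of integers. $G$ is interval colorable if it has an interval $t$-coloring for some positive integer $t$; then $W(G)$ denotes the maximum such $t$. The Cartesian product $G\square H$ has vertex set $V(G)\times V(H)$, with $(u_1,v_1)$ and $(u_2,v_2)$ adjacent iff ($u_1=u_2$ and $v_1v_2\in E(H)$) or ($v_1=v_2$ and $u_1u_2\in E(G)$). For an edge-coloring $\alpha$ and a vertex $v$, $S(v,\alpha)$ is the set of colors of the edges incident to $v$. For a connected graph $G$ and $x\in V(G)$, $\epsilon(x)$ is the eccentricity of $x$, and $N_i(x)=\{v\in V(G): d(v,x)=i\}$ for $0\le i\le \epsilon(x)$. For a proper edge-coloring $\alpha$ of $G$ and $v\in N_i(x)$ with $1\le i\le\epsilon(x)$, put $$S_x^-(v,\alpha)=\{\alpha(uv): uv\in E(G),\ u\in N_{i-1}(x)\cup N_i(x)\},\qquad S_x^+(v,\alpha)=\{\alpha(uv): uv\in E(G),\ u\in N_{i+1}(x)\},$$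 and put $S_x^-(x,\alpha)=\emptyset$, $S_x^+(x,\alpha)=S(x,\alpha)$. A vertex $v$ is separable with respect to $x$ if $\max S_x^-(v,\alpha)<\min S_x^+(v,\alpha)$, with the conventions $\max\emptyset=-\infty$ and $\min\emptyset=+\infty$. An interval edge-coloring $\alpha$ of $G$ is a separable interval coloring with respect to $x$ if every vertex of $G$ is separable with respect to $x$; it is a separable interval $t$-coloring if moreover it is an interval $t$-coloring. *)

(* Defs.v *)
From HB Require Import structures.
From mathcomp Require Import all_boot all_order all_algebra.
From mathcomp Require Import boolp constructive_ereal.

Set Implicit Arguments.
Unset Strict Implicit.
Unset Printing Implicit Defensive.

Import Order.TTheory GRing.Theory Num.Theory.

Record sgraph := SGraph {
  vertex :> finType;
  adj : rel vertex;
  adj_sym : symmetric adj;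
  adj_irr : irreflexive adj }.

Section Graphs.
Variable G : sgraph.
Implicit Types (u v x : G) (n i r : nat).

Definition connected := forall u v, connect (@adj G) u v.

Definition regular r := forall v, #|[set u | adj v u]| = r.

Definition edges : {set {set G}} :=
  [set [set p.1; p.2] | p : G * G & adj p.1 p.2].

Definition walk u v n :=
  [exists p : n.-tuple G, path (@adj G) u p && (last u p == v)].

(* The least length of a walk from u to v; it is #|G| when there is none
   (see [dist_le] and [walk_dist]). *)
Definition dist u v := find (walk u v) (iota 0 #|G|).

Definition ecc x := \max_(v : G) dist v x.

Definition level i x := [set v | dist v x == i].

Lemma walkP u v n :
  reflect (exists p, [/\ path (@adj G) u p, last u p = v & size p = n])
          (walk u v n).
Proof.
apply: (iffP existsP) => [[p /andP[pp /eqP pl]]|[p [pp pl ps]]].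
  by exists p; rewrite size_tuple.
by exists (Tuple (introT eqP ps)); rewrite pp pl eqxx.
Qed.

Lemma connect_walk u v :
  connect (@adj G) u v -> exists2 n, n < #|G| & walk u v n.
Proof.
case/connectP => p pp ->; case/shortenP: pp => p' pp' up' _.
exists (size p'); last by apply/walkP; exists p'.
by rewrite -[_.+1]/(size (u :: p')) -(card_uniqP up') max_card.
Qed.

Lemma walk_dist u v : connect (@adj G) u v -> walk u v (dist u v).
Proof.
case/connect_walk => n ltn wn.
have hw : has (walk u v) (iota 0 #|G|).
  by apply/hasP; exists n => //; rewrite mem_iota.
have := nth_find 0 hw; rewrite nth_iota //.
by move: hw; rewrite has_find size_iota.
Qed.

Lemma dist_le u v n : walk u v n -> dist u v <= n.
Proof.
move=> wn; case: (ltnP n #|G|) => [ltn|]; last first.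
  by apply: leq_trans; rewrite -[leqRHS](size_iota 0) find_size.
rewrite leqNgt; apply/negP => /(before_find 0).
by rewrite nth_iota // add0n wn.
Qed.

End Graphs.

(* An edge-coloring is a function on vertex sets, of which only the values at
   the edges [set u; v] matter. *)
Section Colorings.
Variable G : sgraph.
Implicit Types (u v w x : G) (a : {set G} -> nat) (t c : nat) (A : {set G}).

(* Finite sets of colors are represented by sequences, up to membership. *)
Definition colors_to a v A : seq nat :=
  [seq a [set v; u] | u in [set u in A | adj v u]].

Definition colors_at a v : seq nat := colors_to a v [set: G].

Definition proper a :=
  forall v u w, adj v u -> adj v w -> u != w -> a [set v; u] != a [set v; w].

Definition nat_interval (s : seq nat) :=
  forall c1 c2 c, c1 \in s -> c2 \in s -> c1 <= c <= c2 -> c \in s.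

Definition interval_coloring t a :=
  [/\ 0 < t,
      proper a,
      forall u v, adj u v -> 1 <= a [set u; v] <= t,
      forall c, 1 <= c <= t -> exists u v, adj u v /\ a [set u; v] = c
    & forall v, nat_interval (colors_at a v)].

Definition interval_colorable := exists t a, interval_coloring t a.

Definition Sminus x a v : seq nat :=
  if v == x then [::]
  else colors_to a v (level (dist v x).-1 x :|: level (dist v x) x).

Definition Splus x a v : seq nat :=
  if v == x then colors_at a x else colors_to a v (level (dist v x).+1 x).

Definition max_colors (s : seq nat) : \bar int :=
  \big[Order.max/-oo%E]_(c <- s) (c%:Z)%:E.

Definition min_colors (s : seq nat) : \bar int :=
  \big[Order.min/+oo%E]_(c <- s) (c%:Z)%:E.

Definition separable x a v :=
  (max_colors (Sminus x a v) < min_colors (Splus x a v))%E.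

Definition separable_interval_coloring x t a :=
  interval_coloring t a /\ forall v, separable x a v.

Lemma separableP x a v :
  reflect {in Sminus x a v & Splus x a v, forall c1 c2, c1 < c2}
          (separable x a v).
Proof.
rewrite /separable /max_colors /min_colors.
elim: (Sminus x a v) => [|c s IHs].
  rewrite big_nil; apply: (iffP idP) => // _.
  by elim/big_ind: _ => [|p q hp hq|c _]; rewrite ?lt_min ?hp ?hq ?ltNyr.
rewrite big_cons gt_max.
have cP : reflect {in Splus x a v, forall c2, c < c2}
    ((c%:Z)%:E < \big[Order.min/+oo]_(c <- Splus x a v) (c%:Z)%:E)%E.
  elim: (Splus x a v) => [|d l IHl].
    by rewrite big_nil ltry; apply: ReflectT.
  rewrite big_cons lt_min lte_fin ltz_nat.
  apply: (iffP andP) => [[cd /IHl h] c2|h].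
    by rewrite inE => /predU1P[->|/h].
  split; first by apply: h; rewrite mem_head.
  by apply/IHl => c2 c2l; apply: h; rewrite inE c2l orbT.
apply: (iffP andP) => [[/cP h1 /IHs h2] c1 c2|h].
  by rewrite inE => /predU1P[->|c1s] hc2; [apply: h1|apply: h2].
split; first by apply/cP => c2; apply: h; rewrite mem_head.
by apply/IHs => c1 c2 c1s; apply: h; rewrite inE c1s orbT.
Qed.

(* The largest t such that there is an interval t-coloring, and 0 when there
   is none. The bound #|edges G| loses nothing, because all t colors are used:
   see [W_max] and [W_attained]. *)
Definition W :=
  \max_(t < #|edges G|.+1 | `[< exists a, interval_coloring t a >]) t.

Lemma mem_edges u v : adj u v -> [set u; v] \in edges G.
Proof. by move=> uv; apply/imsetP; exists (u, v); rewrite ?inE. Qed.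

Lemma interval_coloring_le t a : interval_coloring t a -> t <= #|edges G|.
Proof.
case=> _ _ _ used _.
have sub : {subset iota 1 t <= [seq a e | e in edges G]}.
  move=> c; rewrite mem_iota add1n ltnS => /used[u [v [uv <-]]].
  by apply: image_f; apply: mem_edges.
by have := uniq_leq_size (iota_uniq 1 t) sub; rewrite size_iota size_image.
Qed.

Lemma W_max t a : interval_coloring t a -> t <= W.
Proof.
move=> ta; have lt : t < #|edges G|.+1 by rewrite ltnS (interval_coloring_le ta).
by apply: (@leq_bigmax_cond _ _ _ (Ordinal lt)); apply/asboolP; exists a.
Qed.

Lemma W_gt0 : 0 < W <-> interval_colorable.
Proof.
split=> [|[t [a ta]]]; last by apply: leq_trans (W_max ta); case: ta.
rewrite /W; case: (pickP (fun t : 'I_#|edges G|.+1 =>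
  `[< exists a, interval_coloring t a >])) => [t /asboolP[a ta] _|no].
  by exists t, a.
by rewrite big_pred0.
Qed.

Lemma W_attained : interval_colorable -> exists a, interval_coloring W a.
Proof.
case=> t [a ta].
have lt : t < #|edges G|.+1 by rewrite ltnS (interval_coloring_le ta).
rewrite /W (bigop.bigmax_eq_arg (Ordinal lt)); last by apply/asboolP; exists a.
by case: arg_maxnP => [|i /asboolP //]; apply/asboolP; exists a.
Qed.

End Colorings.

Section Product.
Variables G H : sgraph.

Definition prod_adj : rel (G * H) := fun p q =>
  (p.1 == q.1) && adj p.2 q.2 || (p.2 == q.2) && adj p.1 q.1.

Lemma prod_adj_sym : symmetric prod_adj.
Proof.
move=> p q; rewrite /prod_adj (eq_sym p.1) (eq_sym p.2).
by rewrite (@adj_sym G p.1) (@adj_sym H p.2).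
Qed.

Lemma prod_adj_irr : irreflexive prod_adj.
Proof. by move=> p; rewrite /prod_adj !adj_irr !andbF. Qed.

Definition cart_prod := SGraph prod_adj_sym prod_adj_irr.

End Product.

Notation "G □ H" := (cart_prod G H) (at level 40, left associativity).

(* Main.v *)
Require Import Defs.
From mathcomp Require Import all_boot.
From mathcomp Require Import zify.

(** Write d v for the distance from v to x. Separability provides at each
    vertex v of G a threshold p v: the edges at v that do not lead away from x
    have colors at most p v, the others have larger colors
    ([separable_threshold]). In the r-regular graph H, the colors at w form a
    block b w + 1, ..., b w + r ([nat_interval_iota]).

    In G □ H, the idea is to insert at (v, w) the r colors of the H-edges
    exactly between the inward and the outward G-edges of v. Let
    K = d v * r + b w. Shift the inward colors by K and the outward ones by
    K + r; the gap that opens is p v + K + 1, ..., p v + K + r, which is what the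
    H-edges at (v, w) receive if their beta-colors are shifted by p v + d v * r.
    An outward edge at v is an inward edge at a vertex of the next level, whose
    distance is d v + 1, so both ends agree on its shift, namely
    maxn (d u) (d v) * r + b w for the edge between u and v in the copy of G
    at w. The shift of an H-edge depends on v only. This gives
    [prod_coloring]; [mem_prod_colors] describes its spectra, which are
    intervals by [prod_colors_interval].

    The smallest threshold is p x = 0, so the copy of H at x has the colors of
    beta. At the vertex y on the last level, p y = tG, so the copy of H at y has
    the colors of beta shifted by tG + ecc x * r, which ends at
    tG + tH + ecc x * r. Following a path from x to y in one copy of G, the
    spectra are intervals and neighbors share a color, so that no intermediate
    color is skipped ([interval_path]). *)

Set Implicit Arguments.
Unset Strict Implicit.
Unset Printing Implicit Defensive.

(** * Spectra of vertices *)

Section Spectra.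
Variables (G : sgraph) (a : {set G} -> nat).

Lemma mem_colors_to v (A : {set G}) c :
  reflect (exists2 u, u \in A /\ adj v u & c = a [set v; u])
          (c \in colors_to a v A).
Proof.
apply: (iffP imageP) => [[u]|[u [uA vu] ->]]; last by exists u; rewrite ?inE ?uA.
by rewrite inE => /andP[uA vu] ->; exists u.
Qed.

Lemma mem_colors_at v c :
  reflect (exists2 u, adj v u & c = a [set v; u]) (c \in colors_at a v).
Proof.
apply: (iffP (mem_colors_to _ _ _)) => [[u [_ vu] ->]|[u vu ->]];
  by exists u; rewrite ?inE.
Qed.

Lemma colors_at_adj {v u} : adj v u -> a [set v; u] \in colors_at a v.
Proof. by move=> vu; apply/mem_colors_at; exists u. Qed.

Lemma proper_uniq_colors v : Defs.proper a -> uniq (colors_at a v).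
Proof.
move=> pa; rewrite map_inj_in_uniq ?enum_uniq // => u w.
rewrite !mem_enum !inE /= => vu vw e.
by apply/eqP/negPn/negP => uw; have := pa _ _ _ vu vw uw; rewrite e eqxx.
Qed.

Lemma size_colors_at r v : regular G r -> size (colors_at a v) = r.
Proof.
by move=> reg; rewrite size_image -(reg v); apply: eq_card => u; rewrite !inE.
Qed.

(** A discrete intermediate value theorem: consecutive vertices of a path share
    the color of the edge between them, so their spectra overlap and the union
    of the spectra along the path has no gap. *)
Lemma interval_path u v c c1 c2 :
  (forall z, nat_interval (colors_at a z)) -> connect (@adj G) u v ->
  c1 \in colors_at a u -> c2 \in colors_at a v -> c1 <= c <= c2 ->
  exists z z', adj z z' /\ a [set z; z'] = c.
Proof.
move=> int /connectP[s ps ->] {v}.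
elim: s u c1 ps => [|v s IHs] u c1 /= => [_|/andP[uv ps]] c1u c2v /andP[c1c cc2].
  have /mem_colors_at[z uz ->] := int u _ _ c c1u c2v (introT andP (conj c1c cc2)).
  by exists u, z.
case: (leqP c (a [set u; v])) => [cuv|uvc].
  have := int u _ _ c c1u (colors_at_adj uv); rewrite c1c cuv => /(_ isT).
  by case/mem_colors_at=> z uz ->; exists u, z.
apply: (IHs v (a [set v; u])) => //; first by rewrite colors_at_adj // adj_sym.
by rewrite setUC (ltnW uvc).
Qed.

End Spectra.

(** Counting determines an interval of colors from its least element b + 1. The
    bound keeps the shifts by b, used in the product coloring, within the range
    of available colors. *)
Lemma nat_interval_iota (s : seq nat) t :
  uniq s -> nat_interval s -> (forall c, c \in s -> 1 <= c <= t) ->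
  exists2 b, b + size s <= t & s =i iota b.+1 (size s).
Proof.
move=> us ints st; case: (posnP (size s)) => [/size0nil ->|s0]; first by exists 0.
have exm : exists c, c \in s by exists (nth 0 s 0); apply: mem_nth.
case: (ex_minnP exm) => m ms minm.
have [m1 _] := andP (st _ ms).
have sub : {subset s <= iota m (size s)}.
  move=> c cs; rewrite mem_iota minm //=.
  (* All of m, ..., c lie in s, so c - m + 1 is at most the size of s. *)
  have := @uniq_leq_size _ (iota m (c - m).+1) s (iota_uniq _ _).
  rewrite size_iota => /(_ _); have := minm _ cs => mc H.
  have : c - m < size s; last by lia.
  by apply: H => e; rewrite mem_iota => le; apply: (ints m c e) => //; lia.
have [|_ es] := uniq_min_size us sub; first by rewrite size_iota.
exists m.-1; last by rewrite prednK.
have : m + (size s).-1 \in s by rewrite es mem_iota; lia.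
by move/st; lia.
Qed.

(** * Distance levels and separability *)

Section Distance.
Variables (G : sgraph) (x : G).
Hypothesis connG : connected G.

Lemma dist_adj u v : adj u v -> dist u x <= (dist v x).+1.
Proof.
move=> uv; have /walkP[s [ps ls ss]] := walk_dist (connG v x).
by apply/dist_le/walkP; exists (v :: s); split=> //=; rewrite ?uv ?ss.
Qed.

Lemma dist_refl : dist x x = 0.
Proof. by apply/eqP; rewrite -leqn0; apply/dist_le/walkP; exists [::]. Qed.

Lemma dist_eq0 v : dist v x = 0 -> v = x.
Proof.
move=> d0; have := walk_dist (connG v x).
by rewrite d0 => /walkP[s [_ <-]] /size0nil ->.
Qed.

Lemma closer_neighbor v : v != x -> exists2 u, adj v u & dist u x < dist v x.
Proof.
move=> vx; have /walkP[[|u s] [/= ps ls <-]] := walk_dist (connG v x).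
  by rewrite ls eqxx in vx.
have [vu pu] := andP ps; exists u => //; rewrite ltnS.
by apply/dist_le/walkP; exists s.
Qed.

Lemma farther_neighbor u v :
  adj v u -> dist v x < dist u x -> dist u x = (dist v x).+1.
Proof. by rewrite adj_sym => /dist_adj; lia. Qed.

(** The threshold is the largest inward color of v, or 0 at x, which has no
    inward edge. In the first case it is a color at v, in the second case its
    successor 1 is; either way no color of the interval at v is lost next to the
    threshold, so the H-colors inserted there will leave no gap. *)
Lemma separable_threshold (a : {set G} -> nat) v :
  separable x a v -> 1 \in colors_at a x ->
  (forall u, adj v u -> 1 <= a [set v; u]) ->
  exists p, [/\ forall u, adj v u -> dist u x <= dist v x -> a [set v; u] <= p,
                forall u, adj v u -> dist v x < dist u x -> p < a [set v; u]
              & (p \in colors_at a v) || (p.+1 \in colors_at a v)].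
Proof.
move=> /separableP; rewrite /Sminus /Splus.
have [-> _ x1 pos|vx sep _ _] := eqVneq v x.
  exists 0; split=> [u xu|u /pos //|]; last by rewrite x1 orbT.
  rewrite dist_refl leqn0 => /eqP/dist_eq0 ux.
  by rewrite ux adj_irr in xu.
have low u : adj v u -> dist u x <= dist v x ->
    u \in level (dist v x).-1 x :|: level (dist v x) x.
  by move=> vu duv; have := dist_adj vu; rewrite !inE; lia.
set S := colors_to _ _ _ in sep.
have [u0 vu0 du0] := closer_neighbor vx.
have exS : exists c, c \in S.
  exists (a [set v; u0]); apply/mem_colors_to; exists u0 => //.
  by split=> //; apply/low/ltnW.
have bS c : c \in S -> c <= \max_(c <- S) c by move=> cS; apply: leq_bigmax_seq.
have [p pS maxp] := ex_maxnP exS bS.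
exists p; split=> [u vu du|u vu du|].
- by apply/maxp/mem_colors_to; exists u => //; split=> //; apply: low.
- apply: sep => //; apply/mem_colors_to; exists u => //; split=> //.
  by rewrite inE (farther_neighbor vu du).
- by case/mem_colors_to: pS => u [_ vu] ->; rewrite colors_at_adj.
Qed.

End Distance.

(** * The coloring of the product *)

Section ProductColoring.
Variables (G H : sgraph) (alpha : {set G} -> nat) (beta : {set H} -> nat).
Variables (d p : G -> nat) (b : H -> nat) (r : nat).
Implicit Types (u v : G) (w : H).

(** An edge of the product is an H-edge when its first projection is a single
    vertex. The maxima recover that vertex, or the vertex w of the copy of G, as
    the only element of a projection; only the maximum of d is a true one. *)
Definition prod_coloring (e : {set G □ H}) : nat :=
  let A := [set z.1 | z in e] in
  let B := [set z.2 | z in e] in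
  if #|A| == 1 then beta B + \max_(v in A) (p v + d v * r)
  else alpha A + (\max_(v in A) d v) * r + \max_(w in B) b w.

Lemma prod_coloring_snd v w w' :
  prod_coloring [set ((v, w) : G □ H); (v, w')] =
  beta [set w; w'] + p v + d v * r.
Proof.
by rewrite /prod_coloring !imsetU1 !imset_set1 /= setUid cards1 eqxx big_set1 addnA.
Qed.

Lemma prod_coloring_fst v u w : adj v u ->
  prod_coloring [set ((v, w) : G □ H); (u, w)] =
  alpha [set v; u] + maxn (d v) (d u) * r + b w.
Proof.
move=> vu; have nvu : v != u.
  by apply: contraTneq vu => ->; rewrite adj_irr.
rewrite /prod_coloring !imsetU1 !imset_set1 /= setUid cards2 nvu /= big_set1.
by rewrite big_setU1 ?inE // big_set1.
Qed.

Hypothesis low : forall v u, adj v u -> d u <= d v -> alpha [set v; u] <= p v.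
Hypothesis high : forall v u, adj v u -> d v < d u -> p v < alpha [set v; u].
Hypothesis step : forall v u, adj v u -> d v < d u -> d u = (d v).+1.
Hypothesis block : forall w, colors_at beta w =i iota (b w).+1 r.

(** The three kinds of edges at (v, w), with colors written relative to the
    common shift d v * r + b w of the inward edges. Their colors lie in
    three successive ranges. *)
Variant prod_edge_spec v w : G * H -> nat -> Prop :=
| ProdEdgeLow u of adj v u & alpha [set v; u] <= p v :
    prod_edge_spec v w (u, w) (alpha [set v; u] + (d v * r + b w))
| ProdEdgeMid w' of adj w w' & b w < beta [set w; w'] <= b w + r :
    prod_edge_spec v w (v, w') (beta [set w; w'] + p v + d v * r)
| ProdEdgeHigh u of adj v u & p v < alpha [set v; u] :
    prod_edge_spec v w (u, w) (alpha [set v; u] + (d v * r + b w) + r).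

Lemma prod_edgeP v w (q : G □ H) :
  adj ((v, w) : G □ H) q ->
  prod_edge_spec v w q (prod_coloring [set ((v, w) : G □ H); q]).
Proof.
case: q => u w' /orP[]/andP[/= /eqP <-].
  move=> ww'; rewrite prod_coloring_snd; constructor=> //.
  by have := colors_at_adj beta ww'; rewrite block mem_iota; lia.
move=> vu; rewrite prod_coloring_fst //.
case: (leqP (d u) (d v)) => duv.
  by rewrite -addnA; constructor=> //; apply: low.
rewrite (step vu duv) mulSn.
have -> : alpha [set v; u] + (r + d v * r) + b w =
          alpha [set v; u] + (d v * r + b w) + r by lia.
by constructor=> //; apply: high.
Qed.

(** Edges of different kinds are told apart by their ranges, edges of the same
    kind by alpha or beta. *)
Lemma prod_coloring_proper :
  Defs.proper alpha -> Defs.proper beta -> Defs.proper prod_coloring.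
Proof.
move=> pa pb [v w] q1 q2 vq1 vq2.
have := prod_edgeP vq2; have := prod_edgeP vq1.
case=> [u vu le|w1 ww1 /andP[l1 l2]|u vu lt];
  case=> [u' vu' le'|w1' ww1' /andP[l1' l2']|u' vu' lt'] neq; try lia.
- have /(pa _ _ _ vu vu') : u != u' by apply: contra_neq neq => ->.
  by lia.
- have /(pb _ _ _ ww1 ww1') : w1 != w1' by apply: contra_neq neq => ->.
  by lia.
- have /(pa _ _ _ vu vu') : u != u' by apply: contra_neq neq => ->.
  by lia.
Qed.

(** The spectrum at (v, w) is a translate of the spectrum of alpha at v, cut at
    the threshold and pulled apart by r, with the gap filled. *)
Lemma mem_prod_colors v w c :
  c \in colors_at prod_coloring ((v, w) : G □ H) <->
  [\/ exists s, [/\ s \in colors_at alpha v, s <= p v & c = s + (d v * r + b w)],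
      p v + (d v * r + b w) < c <= p v + (d v * r + b w) + r
    | exists s, [/\ s \in colors_at alpha v, p v < s
                   & c = s + (d v * r + b w) + r]].
Proof.
split=> [/mem_colors_at[q vq ->]|].
  case: (prod_edgeP vq) => [u vu le|w' ww' le|u vu lt].
  - by constructor 1; exists (alpha [set v; u]); rewrite colors_at_adj.
  - by constructor 2; lia.
  - by constructor 3; exists (alpha [set v; u]); rewrite colors_at_adj.
have adj1 u : adj v u -> adj ((v, w) : G □ H) ((u, w) : G □ H).
  by move=> vu; rewrite /= /prod_adj /= vu eqxx orbT.
case=> [[s [/mem_colors_at[u vu ->] le ->]]|cK|[s [/mem_colors_at[u vu ->] lt ->]]].
- apply/mem_colors_at; exists ((u, w) : G □ H); first exact: adj1.
  rewrite prod_coloring_fst //; have -> : maxn (d v) (d u) = d v; last by lia.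
  by case: (leqP (d u) (d v)) => // /(high vu); lia.
- have : c - (p v + d v * r) \in colors_at beta w.
    by rewrite block mem_iota; lia.
  case/mem_colors_at=> w' ww' E; apply/mem_colors_at; exists ((v, w') : G □ H).
    by rewrite /= /prod_adj /= ww' eqxx.
  by rewrite prod_coloring_snd; lia.
- apply/mem_colors_at; exists ((u, w) : G □ H); first exact: adj1.
  rewrite prod_coloring_fst //; have -> : maxn (d v) (d u) = (d v).+1; last by lia.
  by case: (leqP (d u) (d v)) => [/(low vu)|/(step vu)]; lia.
Qed.

(** As p v or p v + 1 is a color at v, each of the two parts of the cut
    spectrum, when nonempty, reaches the cut and hence the filled gap. *)
Lemma prod_colors_interval v w :
  nat_interval (colors_at alpha v) ->
  (p v \in colors_at alpha v) || ((p v).+1 \in colors_at alpha v) ->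
  nat_interval (colors_at prod_coloring ((v, w) : G □ H)).
Proof.
move=> int pS c1 c2 c /mem_prod_colors c1S /mem_prod_colors c2S cc.
apply/mem_prod_colors; set K := d v * r + b w in c1S c2S *.
case: (leqP c (p v + K)) => [cK|Kc].
  case: c1S => [[s [sS sp e1]]||[s [_ ? ?]]]; [|lia|lia].
  constructor 1; exists (c - K); split; [|lia|lia].
  by case/orP: pS => pS; apply: (int _ _ _ sS pS); lia.
case: (leqP c (p v + K + r)) => [cK|Kc']; first by constructor 2; lia.
case: c2S => [[s [_ ? ?]]||[s [sS sp e2]]]; [lia|lia|].
constructor 3; exists (c - K - r); split; [|lia|lia].
by case/orP: pS => pS; apply: (int _ _ _ pS sS); lia.
Qed.

End ProductColoring.

Lemma connect_prod_fst (G H : sgraph) (u v : G) (w : H) :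
  connect (@adj G) u v ->
  connect (@adj (G □ H)) ((u, w) : G □ H) ((v, w) : G □ H).
Proof.
case/connectP=> s ps ->; elim: s u ps => [|z s IHs] u /= => [_|/andP[uz ps]].
  exact: connect0.
apply: connect_trans (IHs z ps); apply: connect1.
by rewrite /= /prod_adj /= uz eqxx orbT.
Qed.

Theorem theorem4p4 (G : sgraph) (x : G) (alpha : {set G} -> nat) (tG : nat) :
  connected G ->
  separable_interval_coloring x tG alpha ->
  1 \in colors_at alpha x ->
  (exists y : G, y \in level (ecc x) x /\ tG \in colors_at alpha y) ->
  forall (H : sgraph) (r tH : nat),
    regular H r ->
    (exists beta : {set H} -> nat, interval_coloring tH beta) ->
    W (G □ H) >= tG + tH + ecc x * r.
Proof.
move=> conn [[tG0 pa bounda _ inta] sep] x1 [y [yecc ytG]] H r tH reg.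
case=> beta [tH0 pb boundb usedb intb].
have posa v u : adj v u -> 1 <= alpha [set v; u] by case/bounda/andP.
have /fin_all_exists[p hp] v := separable_threshold conn (sep v) x1 (posa v).
have /fin_all_exists[b hb] w :
    exists b, b + r <= tH /\ colors_at beta w =i iota b.+1 r.
  rewrite -(size_colors_at beta w reg).
  have [||c /mem_colors_at[w' ww' ->]|b ? ?] :=
    @nat_interval_iota (colors_at beta w) tH; last by exists b.
  - exact: proper_uniq_colors.
  - exact: intb.
  - exact: boundb.
pose d v := dist v x.
have low v u : adj v u -> d u <= d v -> alpha [set v; u] <= p v.
  by case: (hp v) => l _ _; apply: l.
have high v u : adj v u -> d v < d u -> p v < alpha [set v; u].
  by case: (hp v) => _ h _; apply: h.
have step v u : adj v u -> d v < d u -> d u = (d v).+1 by apply: farther_neighbor.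
have block w : colors_at beta w =i iota (b w).+1 r by case: (hb w).
have d_ecc v : d v <= ecc x by apply: leq_bigmax.
have dx : d x = 0 by apply: dist_refl.
have dy : d y = ecc x by move: yecc; rewrite inE => /eqP.
have px : p x = 0.
  have /mem_colors_at[u xu E] := x1.
  have : 0 < d u.
    rewrite lt0n; apply/eqP => /(dist_eq0 conn) ux.
    by rewrite ux adj_irr in xu.
  by rewrite -dx => /(high _ _ xu); lia.
have py : tG <= p y.
  have /mem_colors_at[u yu ->] := ytG.
  by apply: low => //; rewrite dy.
have p_tG v : p v <= tG.
  have [_ _ /orP[]/mem_colors_at[u vu]] := hp v; by have := bounda _ _ vu; lia.
pose gamma := prod_coloring alpha beta d p b r.
have gint z : nat_interval (colors_at gamma z).
  case: z => v w; apply: (prod_colors_interval low high step block (inta v)).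
  by case: (hp v).
apply: (@W_max _ _ gamma); split=> //.
- by lia.
- exact: prod_coloring_proper.
- move=> [v w] q vq; rewrite /gamma.
  have dr : d v * r <= ecc x * r by rewrite leq_mul2r d_ecc orbT.
  have [bw _] := hb w; have pv := p_tG v.
  case: (prod_edgeP low high step block vq) => [u vu le|w' ww' le|u vu lt].
  + by have := posa _ _ vu; lia.
  + by have := boundb _ _ ww'; lia.
  + have [] := andP (bounda _ _ vu); case: (leqP (d u) (d v)) => [/(low _ _ vu)|duv].
      by lia.
    have : (d v).+1 * r <= ecc x * r by rewrite leq_mul2r -(step _ _ vu duv) d_ecc orbT.
    by rewrite mulSn; lia.
- have snd_adj v w w' : adj w w' -> adj ((v, w) : G □ H) ((v, w') : G □ H).
    by move=> ww'; rewrite /= /prod_adj /= ww' eqxx.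
  move=> c ct; case: (leqP c (tG + ecc x * r)) => cle; last first.
    (* The top tH colors all occur in the copy of H at y. *)
    have [|w [w' [ww' E]]] := usedb (c - (tG + ecc x * r)); first by lia.
    exists ((y, w) : G □ H), ((y, w') : G □ H); split; first exact: snd_adj.
    by rewrite /gamma prod_coloring_snd dy; have := p_tG y; lia.
  (* An H-edge of beta-color 1 at w: its copies at x and y have the colors 1
     and 1 + tG + ecc x * r. *)
  have [|w [w' [ww' E]]] := usedb 1; first by lia.
  apply: (interval_path (c1 := 1) (c2 := 1 + tG + ecc x * r) gint
            (connect_prod_fst w (conn x y))); last by lia.
  + apply/mem_colors_at; exists ((x, w') : G □ H); first exact: snd_adj.
    by rewrite /gamma prod_coloring_snd E px dx.
  + apply/mem_colors_at; exists ((y, w') : G □ H); first exact: snd_adj.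
    by rewrite /gamma prod_coloring_snd E dy; have := p_tG y; lia.
Qed.
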